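(* Let $q$ be an odd prime power with $q\equiv 1 \pmod 4$, and let $a,b,c\in F_q^\ast$ with $ab=c^2$. Write $C_1^n=\sum_{j\in F_q^+}\alpha_{n,j}C_j$ for the distribution after $n$ steps of the random walk by $C_1$ started at $C_0$. Then \[ \lim_{n\to\infty} C_1^n=\frac{1}{q^2}C_0+\frac{2(q-1)}{q^2}C_q+\frac{q-1}{q^2}\sum_{i\in F_q^\ast}C_i, \] i.e. $\alpha_{n,0}\to 1/q^2$, $\alpha_{n,q}\to 2(q-1)/q^2$ and $\alpha_{n,i}\to (q-1)/q^2$ for every $i\in F_q^\ast$ as $n\to\infty$. Furthermore, the mixing time of this random walk is linear in $q$: for every fixed $\varepsilon\in(0,1)$ there is a constant $M_\varepsilon$, depending only on $\varepsilon$, such that for all such $q,a,b$ the mixing time satisfies $\tau(\varepsilon)\le M_\varepsilon\, q$.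
   Context: $F_q$ is the finite field with $q$ elements, $F_q^\ast$ its set of non-zero elements, and $F_q^+=F_q\cup\{q\}$, where $q$ is used as one extra formal index not in $F_q$. For $i\in F_q^\ast$ let $C_i=\{(x,y)\in F_q^2: ax^2+by^2=i\}$; let $C_0=\{(0,0)\}$ and $C_q=\{(x,y)\in F_q^2: ax^2+by^2=0,\ (x,y)\ne(0,0)\}$. For $i,j,k\in F_q^+$ let $N_{ij}^k$ be the number of pairs $(A,B)\in C_i\times C_j$ with $A+B\in C_k$, and $n_{ij}^k=N_{ij}^k/(|C_i||C_j|)$. Formal linear combinations of the $C_k$ are multiplied bilinearly by $C_iC_j=\sum_{k\in F_q^+} n_{ij}^kC_k$, and $C_1^n$ denotes the $n$-th power of $C_1$ in this sense; convergence is coefficientwise. The random walk by $C_1$ is the Markov chain on the set $\{C_i\}_{i\in F_q^+}$ with kernel $K(C_i,C_j)=n_{i1}^j$. Thus $\alpha_{n,j}=K^n(C_0,C_j)$. The total variation distance is $d_{\mathrm{TV}}(\mu,\nu)=\frac12\sum_x|\mu(x)-\nu(x)|$. With $\pi$ the stationary distribution of $K$, the mixing time is $\tau(\varepsilon)=\max_{x}\min\{t: d_{\mathrm{TV}}(K^t(x,\cdot),\pi)\le\varepsilon\}$, the maximum being over all states $x$. *)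

(* Defs.v *)
From HB Require Import structures.
From mathcomp Require Import all_boot all_order all_algebra.
From mathcomp Require Import all_classical all_reals all_analysis.
Set Implicit Arguments.
Unset Strict Implicit.
Unset Printing Implicit Defensive.
Import Order.TTheory GRing.Theory Num.Theory.
Local Open Scope ring_scope.

(* The index set F_q^+ = F_q + {q} is [option F]: [Some i] is the index i of
   F_q, and [None] is the extra formal index q. *)
Definition curve (F : finFieldType) (a b : F) (k : option F) : {set F * F} :=
  match k with
  | None => [set v | (a * v.1 ^+ 2 + b * v.2 ^+ 2 == 0) && (v != (0, 0))]
  | Some i => if i == 0 then [set (0, 0)]
              else [set v | a * v.1 ^+ 2 + b * v.2 ^+ 2 == i]
  end.

Definition pair_count (F : finFieldType) (a b : F) (i j k : option F) : nat :=
  #|[set AB : (F * F) * (F * F) | [&& AB.1 \in curve a b i,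
       AB.2 \in curve a b j & AB.1 + AB.2 \in curve a b k]]|.

Definition struct_const (R : realType) (F : finFieldType) (a b : F)
    (i j k : option F) : R :=
  (pair_count a b i j k)%:R / (#|curve a b i|%:R * #|curve a b j|%:R).

(* A formal linear combination \sum_k f_k C_k is the function k |-> f_k. *)
Definition basis_elt (R : realType) (F : finFieldType) (k : option F) :
    {ffun option F -> R} :=
  [ffun j => (j == k)%:R].

Definition comb_mul (R : realType) (F : finFieldType) (a b : F)
    (f g : {ffun option F -> R}) : {ffun option F -> R} :=
  [ffun k => \sum_i \sum_j f i * g j * struct_const R a b i j k].

(* C_1^n, with C_1^0 = C_0 and C_1^(n+1) = C_1^n C_1. *)
Definition C1_pow (R : realType) (F : finFieldType) (a b : F) (n : nat) :
    {ffun option F -> R} :=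
  iter n (fun f => comb_mul a b f (basis_elt R (Some 1)))
    (basis_elt R (Some 0)).

Definition walk_kernel (R : realType) (F : finFieldType) (a b : F)
    (i j : option F) : R :=
  struct_const R a b i (Some 1) j.

Fixpoint kernel_pow (R : realType) (T : finType) (K : T -> T -> R) (t : nat)
    (x y : T) : R :=
  if t is t'.+1 then \sum_z kernel_pow K t' x z * K z y else (x == y)%:R.

Definition stationary (R : realType) (T : finType) (K : T -> T -> R)
    (pi : {ffun T -> R}) : Prop :=
  [/\ forall x, 0 <= pi x, \sum_x pi x = 1
    & forall y, \sum_x pi x * K x y = pi y].

Definition tv_dist (R : realType) (T : finType) (mu nu : T -> R) : R :=
  2^-1 * \sum_x `|mu x - nu x|.

(* The first time at which the walk started at x is within eps of pi, as an
   extended real: it is +oo when there is no such time, and otherwise the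
   infimum is the minimum, attained since the times are natural numbers. *)
Definition hitting_eps (R : realType) (T : finType) (K : T -> T -> R)
    (pi : T -> R) (eps : R) (x : T) : \bar R :=
  ereal_inf [set t%:R%:E | t in
    [set t : nat | tv_dist (kernel_pow K t x) pi <= eps]]%classic.

Definition mixing_time (R : realType) (T : finType) (K : T -> T -> R)
    (pi : T -> R) (eps : R) : \bar R :=
  \big[maxe/-oo%E]_(x : T) hitting_eps K pi eps x.

(* Main.v *)
(* Since -1 and ab are squares, ax^2 + by^2 = uv in suitable linear coordinates,
   so |C_i| = q - 1 for i <> 0 and |C_q| = 2(q - 1), and the uniform measure on
   F_q^2 induces the stationary distribution |C_k| / q^2.
   From any state other than C_0 and C_1 the walk jumps to C_q with probability
   at least 1/(q - 1), and after two steps from an arbitrary state it is outside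
   {C_0, C_1} with probability at least 1/8.  Hence K^3(x, C_q) >= 1/(8(q - 1))
   for every x: this Doeblin condition contracts the total variation distance by
   1 - 1/(8(q - 1)) every three steps, which gives convergence and a mixing time
   linear in q. *)
Require Import Defs.
From HB Require Import structures.
From mathcomp Require Import all_boot all_order all_algebra all_field.
From mathcomp Require Import all_classical all_reals all_analysis.
From mathcomp Require Import ring lra zify.
Set Implicit Arguments.
Unset Strict Implicit.
Unset Printing Implicit Defensive.
Import Order.TTheory GRing.Theory Num.Theory.
Import numFieldNormedType.Exports.
Local Open Scope ring_scope.

(** * Doeblin minorization for finite Markov chains *)

Definition stochastic (R : realType) (T : finType) (K : T -> T -> R) : Prop :=
  (forall x y, 0 <= K x y) /\ forall x, \sum_y K x y = 1.

Section Markov.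
Variables (R : realType) (T : finType) (K : T -> T -> R).

Lemma kernel_powD s t x y :
  kernel_pow K (s + t) x y = \sum_z kernel_pow K s x z * kernel_pow K t z y.
Proof.
elim: t y => [|t IH] y.
  rewrite addn0 (bigD1 y) //= eqxx mulr1 big1 ?addr0 // => z /negPf zy.
  by rewrite zy mulr0.
rewrite addnS /=; under eq_bigr do rewrite IH mulr_suml.
rewrite exchange_big; apply: eq_bigr => z _ /=.
by rewrite mulr_sumr; apply: eq_bigr => w _; rewrite mulrA.
Qed.

Lemma kernel_pow1 x y : kernel_pow K 1 x y = K x y.
Proof.
rewrite /= (bigD1 x) //= eqxx mul1r big1 ?addr0 // => z.
by rewrite eq_sym => /negPf ->; rewrite mul0r.
Qed.

Lemma stochastic_pow t : stochastic K -> stochastic (kernel_pow K t).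
Proof.
move=> [K_ge0 K_sum1]; elim: t => [|t [IH0 IH1]]; split=> //=.
- move=> x; rewrite (bigD1 x) //= eqxx big1 ?addr0 // => z.
  by rewrite eq_sym => /negPf ->.
- by move=> x y; apply: sumr_ge0 => z _; apply: mulr_ge0.
- move=> x; rewrite exchange_big /= -[RHS](IH1 x); apply: eq_bigr => z _.
  by rewrite -mulr_sumr K_sum1 mulr1.
Qed.

Lemma stationary_pow (pi : {ffun T -> R}) t y :
  stationary K pi -> \sum_x pi x * kernel_pow K t x y = pi y.
Proof.
move=> [_ _ piK]; elim: t y => [|t IH] y /=.
  by rewrite (bigD1 y) //= eqxx mulr1 big1 ?addr0 // => x /negPf ->; rewrite mulr0.
rewrite -[RHS]piK; under eq_bigr do rewrite mulr_sumr.
rewrite exchange_big; apply: eq_bigr => z _ /=.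
by rewrite -[in RHS]IH mulr_suml; apply: eq_bigr => x _; rewrite mulrA.
Qed.

(* Since [f] has mass 0, subtracting the constant [d] from the column [y0] of
   [K] changes nothing in [f K], and leaves rows of mass [1 - d]. *)
Lemma minorized_contraction (y0 : T) (d : R) (f : T -> R) :
    stochastic K -> (forall x, d <= K x y0) -> \sum_x f x = 0 ->
  \sum_y `|\sum_x f x * K x y| <= (1 - d) * \sum_x `|f x|.
Proof.
move=> [K_ge0 K_sum1] K_min f0.
pose L x y := K x y - d * (y == y0)%:R.
have L_ge0 x y : 0 <= L x y.
  rewrite /L; case: eqP => [->|_]; first by rewrite mulr1 subr_ge0.
  by rewrite mulr0 subr0.
have fKL y : \sum_x f x * K x y = \sum_x f x * L x y.
  under [RHS]eq_bigr do rewrite mulrBr.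
  by rewrite sumrB -mulr_suml f0 mul0r subr0.
have L_sum x : \sum_y L x y = 1 - d.
  rewrite sumrB K_sum1; congr (_ - _); rewrite -mulr_sumr (bigD1 y0) //= eqxx.
  by rewrite big1 ?addr0 ?mulr1 // => y /negPf ->.
rewrite mulr_sumr; under [leRHS]eq_bigr => x _ do rewrite -(L_sum x) mulr_suml.
rewrite exchange_big; apply: ler_sum => y _ /=; rewrite fKL.
apply: le_trans (ler_norm_sum _ _ _) _; apply: ler_sum => x _.
by rewrite normrM mulrC ger0_norm.
Qed.

(** Keeps only the paths that are in [G] at time [t] and jump to [y] next; all other paths
    contribute nonnegatively. *)
Lemma kernel_pow_step (G : pred T) (y : T) (c d : R) t x :
    stochastic K -> 0 <= d -> (forall z, G z -> d <= K z y) ->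
    c <= \sum_(z | G z) kernel_pow K t x z ->
  c * d <= kernel_pow K t.+1 x y.
Proof.
move=> [K_ge0 K_sum1] d0 Gd cG; have [P_ge0 _] := stochastic_pow t (conj K_ge0 K_sum1).
rewrite /= (bigID G) /= -[leLHS]addr0; apply: lerD; last first.
  by apply: sumr_ge0 => z _; apply: mulr_ge0.
apply: le_trans (ler_wpM2r d0 cG) _; rewrite mulr_suml.
by apply: ler_sum => z Gz; apply: ler_wpM2l => //; exact: Gd.
Qed.

End Markov.

(** Trades geometric decay for a rational bound, enough for a mixing time of order 1/d and free of
    logarithms. The induction rests on (1 - d)(1 + (n+1)d) = 1 + nd - (n+1)d^2. *)
Lemma exprn_le_bernoulli (R : realType) (d : R) (n : nat) :
  0 <= d <= 1 -> (1 - d) ^+ n * (1 + n%:R * d) <= 1.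
Proof.
move=> /andP[d0 d1]; elim: n => [|n IH]; first by rewrite expr0 mul0r addr0 mulr1.
have p0 : 0 <= (1 - d) ^+ n by rewrite exprn_ge0 // subr_ge0.
apply: le_trans IH; rewrite exprSr -mulrA ler_wpM2l // -natr1.
have n0 : 0 <= n%:R * d * d by rewrite !mulr_ge0.
by nra.
Qed.

(** * Convergence, uniqueness and mixing time from a minorization *)

Section Doeblin.
Variables (R : realType) (T : finType) (K : T -> T -> R) (pi : {ffun T -> R}).
Variables (m : nat) (y0 : T) (d : R).
Hypotheses (stochK : stochastic K) (pi_stat : stationary K pi).
Hypothesis d_gt0 : 0 < d.
Hypothesis K_min : forall x, d <= kernel_pow K m x y0.

Let dev t x y := kernel_pow K t x y - pi y.

Let dev_sum0 t x : \sum_y dev t x y = 0.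
Proof.
have [_ P1] := stochastic_pow t stochK; have [_ pi1 _] := pi_stat.
by rewrite sumrB P1 pi1 subrr.
Qed.

Let devD s t x y : dev (s + t) x y = \sum_z dev s x z * kernel_pow K t z y.
Proof.
under eq_bigr do rewrite mulrBl.
by rewrite sumrB stationary_pow // -kernel_powD.
Qed.

Lemma minorization_le1 : d <= 1.
Proof.
have [P0 P1] := stochastic_pow m stochK.
rewrite -(P1 y0) (bigD1 y0) //= -[leLHS]addr0 lerD //.
by apply: sumr_ge0.
Qed.

(** Each block of [m] steps contracts the deviation, of norm at most 2 at the start, by 1 - d; the
    leftover steps do not increase it. *)
Lemma doeblin_deviation n t x : (n * m <= t)%N ->
  (\sum_y `|kernel_pow K t x y - pi y|) * (1 + n%:R * d) <= 2.
Proof.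
move=> nmt; have [pi0 pi1 _] := pi_stat.
have geom k : \sum_y `|dev (k * m) x y| <= (1 - d) ^+ k * 2.
  elim: k => [|k IH].
    rewrite mul0n expr0 mul1r.
    apply: (@le_trans _ _ (\sum_y ((x == y)%:R + pi y))).
      apply: ler_sum => y _; apply: le_trans (ler_normB _ _) _.
      by rewrite !ger0_norm.
    rewrite big_split /= pi1 (bigD1 x) //= eqxx big1 ?addr0 //.
    by move=> y; rewrite eq_sym => /negPf ->.
  rewrite mulSn addnC; under eq_bigr do rewrite devD.
  apply: le_trans (minorized_contraction (stochastic_pow m stochK) K_min _) _ => //.
  by rewrite exprS -mulrA ler_wpM2l // subr_ge0 minorization_le1.
(* A stochastic kernel never expands the norm: this is the contraction lemma with the trivial
   minorization d = 0. *)
have mono : \sum_y `|dev t x y| <= \sum_y `|dev (n * m) x y|.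
  rewrite -[in leLHS](subnKC nmt); under eq_bigr do rewrite devD.
  have [P0 P1] := stochastic_pow (t - n * m) stochK.
  have := minorized_contraction (d := 0) (y0 := y0) (conj P0 P1) _ (dev_sum0 (n * m) x).
  by rewrite subr0 mul1r; apply.
have nd0 : 0 <= 1 + n%:R * d by rewrite addr_ge0 ?mulr_ge0 // ltW.
apply: le_trans (ler_wpM2r nd0 (le_trans mono (geom n))) _.
rewrite mulrAC -[leRHS]mul1r ler_wpM2r //.
by apply: exprn_le_bernoulli; rewrite (ltW d_gt0) minorization_le1.
Qed.

Lemma doeblin_cvg x y :
  ((fun t : nat => kernel_pow K t x y) @ \oo --> (pi y : R))%classic.
Proof.
apply/cvgrPdist_le => e e0.
(* Chosen so that n d e > 2, which makes the bound 2 / (1 + n d) smaller than e. *)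
pose n := (Num.truncn (2 / (e * d))).+1.
near=> t.
have /(doeblin_deviation x) : (n * m <= t)%N by near: t; exact: nbhs_infty_ge.
have n_gt : 2 < n%:R * d * e.
  by rewrite -mulrA [d * e]mulrC -ltr_pdivrMr ?mulr_gt0 // truncnS_gt.
rewrite (bigD1 y) //= distrC => D.
have D0 : 0 <= \sum_(i | i != y) `|kernel_pow K t x i - pi i| by apply: sumr_ge0.
have nd0 : 0 < n%:R * d by rewrite mulr_gt0.
rewrite leNgt; apply/negP => lt_e; move: D; apply/negP; rewrite -ltNge.
apply: lt_le_trans n_gt _.
by nra.
Unshelve. all: by end_near.
Qed.

(** The difference of two stationary distributions has mass 0 and is fixed by the [m]-step kernel,
    which also shrinks its norm by 1 - d < 1; so it vanishes. *)
Lemma doeblin_unique : unique (stationary K) pi.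
Proof.
split=> // pi' pi'_stat; have [_ pi1 _] := pi_stat; have [_ pi'1 _] := pi'_stat.
have f0 : \sum_x (pi x - pi' x) = 0 by rewrite sumrB pi1 pi'1 subrr.
have := minorized_contraction (stochastic_pow m stochK) K_min f0.
have -> : \sum_y `|\sum_x (pi x - pi' x) * kernel_pow K m x y|
    = \sum_y `|pi y - pi' y|.
  apply: eq_bigr => y _; under eq_bigr do rewrite mulrBl.
  by rewrite sumrB !stationary_pow.
rewrite mulrBl mul1r -subr_ge0 addrAC subrr add0r oppr_ge0 pmulr_rle0 // => le0.
apply/ffunP => y; apply/eqP; rewrite -subr_eq0 -normr_le0.
by apply: le_trans le0; rewrite (bigD1 y) //= lerDl sumr_ge0.
Qed.

Lemma doeblin_mixing_time (eps : R) (n : nat) :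
  1 <= eps * (1 + n%:R * d) ->
  (mixing_time K pi eps <= (n * m)%:R%:E)%E.
Proof.
move=> n_large; apply: bigmax_le; first by rewrite leNye.
move=> x _; apply: ereal_inf_lbound; exists (n * m)%N => //=.
rewrite /tv_dist; have := doeblin_deviation x (leqnn (n * m)).
set S := \sum_y _; have nd0 : 0 < 1 + n%:R * d.
  by rewrite ltr_wpDr // mulr_ge0 // ltW.
by move=> S2; rewrite -(ler_pM2r nd0); lra.
Qed.

End Doeblin.

(** * The quadratic form as a hyperbolic plane *)

(** With q - 1 = 4m, some nonzero g has g^(2m) different from 1. As g^(4m) = 1, this forces g^(2m) =
    -1, and g^m is the square root. *)
Lemma exists_sqrt_neg1 (F : finFieldType) :
  #|F| = 1 %[mod 4] -> (1 != - 1 :> F) /\ exists i : F, i ^+ 2 = - 1.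
Proof.
move=> F_mod; have F_gt1 : (1 < #|F|)%N := finNzRing_gt1 F.
have [m Fm] : exists m, #|F| = (4 * m).+1.
  exists (#|F| %/ 4)%N.
  by rewrite [LHS](divn_eq _ 4) F_mod addn1 mulnC.
have m_gt0 : (0 < m)%N by lia.
have [g g0 g_ne1] : exists2 g : F, g != 0 & g ^+ (2 * m) != 1.
  apply/exists_inP; case: exists_inP => // none.
  have all1 (x : F) : x != 0 -> x ^+ (2 * m) = 1.
    by move=> x0; apply: contra_notP none => /eqP x1; exists x.
  (* Otherwise all 4m nonzero elements would be roots of X^(2m) - 1. *)
  have: (size (enum [set~ (0%R : F)]) <= 2 * m)%N.
    apply: max_unity_roots; rewrite ?enum_uniq ?muln_gt0 //.
    apply/allP => x; rewrite mem_enum !inE => x0; apply/unity_rootP.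
    exact: all1.
  by rewrite -cardE cardsC1 Fm; lia.
have g4 : g ^+ (2 * m) ^+ 2 = 1.
  rewrite -exprM; apply: (mulfI g0); rewrite -exprS mulr1.
  by rewrite -[RHS](expf_card g); congr (_ ^+ _); lia.
have gN1 : g ^+ (2 * m) = - 1.
  move/eqP: g4; rewrite sqrf_eq1 (negPf g_ne1) /=; exact: eqP.
split; first by rewrite -gN1 eq_sym.
by exists (g ^+ m); rewrite -exprM mulnC.
Qed.

(** With i^2 = -1 and b = c^2 / a, the form factors as (a x + i c y)(x - (i c / a) y). The two
    factors are independent coordinates because 2 is invertible. Additivity of [f] is kept since the
    structure constants involve sums of vectors. *)
Lemma hyperbolic_coordinates (F : finFieldType) (a b c : F) :
    #|F| = 1 %[mod 4] -> a != 0 -> c != 0 -> a * b = c ^+ 2 ->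
  exists f : F * F -> F * F,
    [/\ bijective f, {morph f : v w / v + w}
      & forall v, a * v.1 ^+ 2 + b * v.2 ^+ 2 = (f v).1 * (f v).2].
Proof.
move=> /exists_sqrt_neg1[n1 [i i2]] a0 c0 abc.
have i0 : i != 0.
  by apply: contraNneq n1 => i0; move/eqP: i2; rewrite i0 expr0n /= eq_sym oppr_eq0 oner_eq0.
have two0 : 2 != 0 :> F by rewrite (_ : 2 = 1 + 1) // -subr_eq0 in n1 *; rewrite opprK in n1.
pose f (v : F * F) := (a * v.1 + i * c * v.2, v.1 - i * c / a * v.2).
pose g (w : F * F) := ((w.1 + a * w.2) / (2 * a), (w.1 - a * w.2) / (2 * i * c)).
exists f; split.
- exists g => -[x y]; rewrite /f /g /=; congr (_, _); field; by rewrite ?two0 ?a0 ?c0 ?i0.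
- by move=> [x y] [z w]; rewrite /f /=; congr (_, _) => /=; ring.
move=> [x y] /=; have -> : b = c ^+ 2 / a by rewrite -abc mulrC mulKf.
have -> : (a * x + i * c * y) * (x - i * c / a * y)
  = a * x ^+ 2 - i ^+ 2 * c ^+ 2 / a * y ^+ 2 by field.
by rewrite i2 mulN1r mulNr mulNr opprK.
Qed.

(** * Structure constants *)

Section Curves.
Variables (R : realType) (F : finFieldType) (a b : F).
Local Notation C := (curve a b).
Local Notation C1 := (C (Some 1)).

(** The curves partition the plane; naming the class of [v] turns membership into an equality of
    indices. *)
Definition curve_index (v : F * F) : option F :=
  if v == (0, 0) then Some 0
  else if a * v.1 ^+ 2 + b * v.2 ^+ 2 == 0 then None
  else Some (a * v.1 ^+ 2 + b * v.2 ^+ 2).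

Lemma mem_curve v k : (v \in C k) = (k == curve_index v).
Proof.
rewrite /curve_index; case: k => [i|] /=; last first.
  by rewrite inE; case: (v == _); case: (_ == 0).
case: (eqVneq v (0, 0)) => [->|v0]; case: (eqVneq i 0) => [->|i0]; rewrite inE.
- by rewrite !eqxx.
- rewrite /= !expr0n /= !mulr0 addr0 eq_sym (negPf i0).
  by apply/esym/negbTE; apply: contraNneq i0 => -[->].
- rewrite (negPf v0); set Q := _ + _; case: (eqVneq Q 0) => // Q0.
  by apply/esym/negbTE; apply: contraNneq Q0 => -[<-].
set Q := _ + _; case: (eqVneq Q 0) => [->|_]; first by rewrite eq_sym (negPf i0).
by apply/eqP/eqP => [->|[]].
Qed.

Lemma curve_indexN v : curve_index (- v) = curve_index v.
Proof.
case: v => x y; rewrite /curve_index /= !sqrrN.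
by rewrite [_ == (0, 0)]xpair_eqE !oppr_eq0 -xpair_eqE.
Qed.

Lemma sum_mem_curve v : (\sum_k (v \in C k) = 1)%N.
Proof.
rewrite (bigD1 (curve_index v)) //= mem_curve eqxx big1 // => k /negPf.
by rewrite mem_curve => ->.
Qed.

Lemma sum_card_curve : (\sum_k #|C k| = #|F| ^ 2)%N.
Proof.
under eq_bigr do rewrite -sum1_card big_mkcond.
rewrite exchange_big -mulnn -card_prod -sum1_card.
apply: eq_bigr => v _ /=; rewrite -[RHS](sum_mem_curve v).
by apply: eq_bigr => k _; case: (v \in C k).
Qed.

Lemma card_curve0 : #|C (Some 0)| = 1%N.
Proof. by rewrite /curve eqxx cards1. Qed.

Lemma pair_countE i j k :
  pair_count a b i j k = (\sum_(A in C i) \sum_(B in C j) ((A + B)%R \in C k))%N.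
Proof.
rewrite /pair_count -sum1dep_card (pair_big_dep _ (fun _ B => B \in C j)) /=.
rewrite [RHS]big_mkcond [LHS]big_mkcond; apply: eq_bigr => -[A B] _ /=.
by case: (A \in _); case: (B \in _); case: (_ \in _).
Qed.

Lemma sum_pair_count_r i j : (\sum_k pair_count a b i j k = #|C i| * #|C j|)%N.
Proof.
under eq_bigr do rewrite pair_countE.
rewrite exchange_big -sum_nat_const; apply: eq_bigr => A _ /=.
rewrite exchange_big -sum1_card; apply: eq_bigr => B _ /=.
exact: sum_mem_curve.
Qed.

(* For each [B], [A |-> A - B] maps [C_k] bijectively to the [A] counted. *)
Lemma sum_pair_count_l j k : (\sum_i pair_count a b i j k = #|C j| * #|C k|)%N.
Proof.
under eq_bigr do rewrite pair_countE exchange_big.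
rewrite exchange_big -sum_nat_const; apply: eq_bigr => B _ /=.
under eq_bigr do rewrite big_mkcond.
rewrite exchange_big -sum1_card [RHS]big_mkcond [RHS](reindex_inj (addIr B)) /=.
apply: eq_bigr => A _; transitivity (((A + B)%R \in C k) * \sum_i (A \in C i))%N.
  by rewrite big_distrr; apply: eq_bigr => i _ /=; case: (A \in _); rewrite ?muln1 ?muln0.
by rewrite sum_mem_curve muln1; case: (_ \in _).
Qed.

Section Kernel.
Hypothesis C_gt0 : forall k, (0 < #|C k|)%N.
Local Notation K := (walk_kernel R a b).
Let D : R := #|C1|%:R.

Let cardR_neq0 k : #|C k|%:R != 0 :> R.
Proof. by rewrite pnatr_eq0 -lt0n. Qed.

(** [K i k] is the average over A in C_i of the proportion of B in C_1 with A + B in C_k, so a bound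
    uniform in A passes to it. *)
Lemma walk_kernel_ge (i k : option F) (n : nat) :
  (forall A, A \in C i -> n <= \sum_(B in C1) ((A + B)%R \in C k))%N ->
  n%:R / D <= K i k.
Proof.
move=> n_le; rewrite /K /walk_kernel /struct_const.
rewrite invfM mulrA ler_wpM2r ?invr_ge0 ?ler0n //.
rewrite ler_pdivlMr ?ltr0n // -natrM ler_nat pair_countE mulnC -sum_nat_const.
exact: leq_sum.
Qed.

Lemma walk_kernel_le (i k : option F) (n : nat) :
  (forall A, A \in C i -> \sum_(B in C1) ((A + B)%R \in C k) <= n)%N ->
  K i k <= n%:R / D.
Proof.
move=> le_n; rewrite /K /walk_kernel /struct_const.
rewrite invfM mulrA ler_wpM2r ?invr_ge0 ?ler0n //.
rewrite ler_pdivrMr ?ltr0n // -natrM ler_nat pair_countE mulnC -sum_nat_const.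
exact: leq_sum.
Qed.

Lemma stochastic_walk : stochastic K.
Proof.
split=> [i k|i]; first by rewrite mulr_ge0 ?invr_ge0 ?mulr_ge0.
by rewrite -mulr_suml -natr_sum sum_pair_count_r natrM divff // mulf_neq0.
Qed.

(** The weight |C_i| cancels the denominator of [K i k], and summing the pair counts over i gives
    |C_1| |C_k|. *)
Lemma stationary_walk :
  stationary K [ffun k => #|C k|%:R / #|F|%:R ^+ 2].
Proof.
have F0 : #|F|%:R != 0 :> R by rewrite pnatr_eq0 -lt0n (ltn_trans _ (finNzRing_gt1 F)).
split=> [k||k].
- by rewrite ffunE divr_ge0 // exprn_ge0.
- under eq_bigr do rewrite ffunE.
  by rewrite -mulr_suml -natr_sum sum_card_curve natrX divff // expf_neq0.
rewrite ffunE; transitivity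
  (\sum_i (pair_count a b i (Some 1) k)%:R * (D^-1 / #|F|%:R ^+ 2)).
  apply: eq_bigr => i _; rewrite ffunE /walk_kernel /struct_const -/D.
  by have := cardR_neq0 i; have := cardR_neq0 (Some 1); rewrite -/D => ? ?; field; apply/and3P; split.
rewrite -mulr_suml -natr_sum sum_pair_count_l natrM.
by have := cardR_neq0 (Some 1); rewrite -/D => ?; field; apply/andP; split.
Qed.

Lemma walk_kernel01 : K (Some 0) (Some 1) = 1.
Proof.
apply/eqP; rewrite eq_le; apply/andP; split.
  have [K0 K1] := stochastic_walk; rewrite -(K1 (Some 0)) (bigD1 (Some 1)) //=.
  by rewrite lerDl sumr_ge0.
rewrite -[leLHS](divff (cardR_neq0 (Some 1))); apply: walk_kernel_ge => A.
rewrite /= eqxx inE => /eqP ->.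
by rewrite -sum1_card; apply: leq_sum => B B1; rewrite add0r B1.
Qed.

(** A + B = 0 leaves only B = -A; since the form is even, -A lies in C_1 only when i = 1. *)
Lemma walk_kernel_to0 i : K i (Some 0) <= (i == Some 1)%:R / D.
Proof.
apply: walk_kernel_le => A; rewrite mem_curve => /eqP ->.
have B_eq B : (A + B \in C (Some 0)) = (B == - A).
  by rewrite /= eqxx inE -[(0, 0)]/(0 : F * F) addrC addr_eq0.
under eq_bigr do rewrite B_eq.
have [A1|A1] := boolP (- A \in C1).
  rewrite (bigD1 (- A)) //= eqxx big1; last by move=> B /andP[_ /negPf ->].
  by move: A1; rewrite mem_curve curve_indexN eq_sym => ->.
by rewrite big1 // => B B1; case: eqP => // BA; rewrite -BA B1 in A1.
Qed.

End Kernel.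

Lemma C1_pow_kernel n k : C1_pow R a b n k = kernel_pow (walk_kernel R a b) n (Some 0) k.
Proof.
elim: n k => [|n IH] k; first by rewrite /C1_pow ffunE eq_sym.
rewrite /C1_pow iterS ffunE; apply: eq_bigr => i _.
rewrite (bigD1 (Some 1)) //= big1 ?addr0; last first.
  by move=> j /negPf j1; rewrite [basis_elt _ _ j]ffunE j1 mulr0 mul0r.
rewrite [basis_elt _ (Some 1) _]ffunE eqxx mulr1; congr (_ * _); exact: IH.
Qed.

End Curves.

(** * Curve sizes and transition bounds in hyperbolic coordinates *)

Section Hyperbolic.
Variables (R : realType) (F : finFieldType) (a b : F) (f : F * F -> F * F).
Hypotheses (f_bij : bijective f) (fD : {morph f : v w / v + w}).
Hypothesis fQ : forall v, a * v.1 ^+ 2 + b * v.2 ^+ 2 = (f v).1 * (f v).2.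
Local Notation C := (curve a b).
Local Notation C1 := (C (Some 1)).
Local Notation K := (walk_kernel R a b).

Let f0 : f 0 = 0.
Proof. by apply: (addrI (f 0)); rewrite -fD !addr0. Qed.

Let f_inj : injective f := bij_inj f_bij.

Let mem_curve_some i v : i != 0 -> (v \in C (Some i)) = ((f v).1 * (f v).2 == i).
Proof. by move=> /negPf i0; rewrite /= i0 inE fQ. Qed.

Let mem_curve_none v : (v \in C None) = ((f v).1 * (f v).2 == 0) && (f v != 0).
Proof. by rewrite inE fQ -[in RHS]f0 (inj_eq f_inj). Qed.

Let coord_neq0 i A : i != Some 0 -> A \in C i -> f A != 0.
Proof.
move=> i0 Ai; apply: contraNneq i0; rewrite -[in X in _ = X -> _]f0 => /f_inj A0.
by move: Ai; rewrite mem_curve A0 /curve_index eqxx.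
Qed.

(** The hyperbola uv = i is parametrized by t -> (t, i / t) with t nonzero. *)
Lemma card_curve_some i : i != 0 -> #|C (Some i)| = #|F|.-1.
Proof.
move=> i0; pose h (t : F) := (t, i / t).
have -> : C (Some i) = f @^-1: [set h t | t in [set~ 0]].
  apply/setP => v; rewrite mem_curve_some // inE; apply/eqP/imsetP.
    move=> fi; have f1 : (f v).1 != 0 by apply: contraNneq i0 => f1; rewrite -fi f1 mul0r.
    exists (f v).1; first by rewrite !inE.
    by rewrite /h -fi mulrAC divff // mul1r; case: (f v).
  by move=> [t]; rewrite !inE => t0 -> /=; rewrite mulrC divfK.
rewrite card_preimset // card_imset ?cardsC1 //.
by move=> t u [].
Qed.

(** By complement in the plane: q^2 - 1 - (q - 1)^2 = 2(q - 1). *)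
Lemma card_curve_none : #|C None| = (2 * #|F|.-1)%N.
Proof.
have := sum_card_curve a b; rewrite (bigD1 None) // (bigD1 (Some 0)) // card_curve0.
set N := #|C None|.
rewrite (eq_bigr (fun=> #|F|.-1)); last first.
  by move=> [i|] //= i0; apply: card_curve_some; apply: contraNneq i0 => ->.
rewrite sum_nat_cond_const.
have -> : [set k : option F | (k != None) && (k != Some 0)] = ~: [set None; Some 0].
  by apply/setP => k; rewrite !inE negb_or.
rewrite cardsCs finset.setCK cards2 card_option.
have : (1 < #|F|)%N := finNzRing_gt1 F.
by case: #|F| => [|[|n]] // _ /=; nia.
Qed.

Lemma card_curve_gt0 k : (0 < #|C k|)%N.
Proof.
have : (1 < #|F|)%N := finNzRing_gt1 F.
case: k => [i|]; last by rewrite card_curve_none; lia.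
have [->|i0] := eqVneq i 0; first by rewrite card_curve0.
by rewrite card_curve_some //; lia.
Qed.

Let D : R := #|C1|%:R.

(* In coordinates [A = (x, y)] and [B = (t, 1/t)], the condition
   [A + B \in C1] is the nonzero polynomial equation [y t^2 + xy t + x = 0]. *)
Lemma walk_kernel_to1 i : i != Some 0 -> K i (Some 1) <= 2 / D.
Proof.
move=> i0; apply: walk_kernel_le; first exact: card_curve_gt0.
move=> A Ai; have fA0 := coord_neq0 i0 Ai.
rewrite -big_mkcondr sum1dep_card.
set S := [set _ | _].
pose p := Poly [:: (f A).1; (f A).1 * (f A).2; (f A).2].
have p0 : p != 0.
  apply: contraNneq fA0 => p0.
  have := congr1 (fun r : {poly F} => r`_0) p0.
  have := congr1 (fun r : {poly F} => r`_2) p0.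
  by rewrite !coef_Poly !coef0 /=; case: (f A) => x y /= -> ->.
(* B is determined by its first coordinate t, a root of [p]; as [p] has size at most 3, there are at
   most 2 of them. *)
rewrite cardE -(size_map (fun B => (f B).1)) -ltnS.
have S_unit B : B \in S -> (f B).1 != 0 /\ (f B).2 = (f B).1^-1.
  rewrite inE mem_curve_some ?oner_neq0 // => /andP[/eqP B1 _].
  have t0 : (f B).1 != 0 by apply: contraTneq (oner_neq0 F) => t0; rewrite -B1 t0 mul0r eqxx.
  by split=> //; apply: (mulfI t0); rewrite B1 divff.
apply: leq_trans (size_Poly [:: (f A).1; (f A).1 * (f A).2; (f A).2]).
apply: max_poly_roots => //.
  apply/allP => t /mapP[B]; rewrite mem_enum => BS ->.
  have [t0 Bt] := S_unit B BS; move: BS.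
  rewrite inE => /andP[_]; rewrite mem_curve_some ?oner_neq0 // fD /= Bt => /eqP AB.
  rewrite /root /p /= !horner_cons hornerC mul0r add0r; apply/eqP.
  (* Multiplying the equation of A + B by t clears the inverse 1/t. *)
  transitivity ((f B).1 * (((f A).1 + (f B).1) * ((f A).2 + (f B).1^-1) - 1)); first by field.
  by rewrite AB subrr mulr0.
rewrite map_inj_in_uniq ?enum_uniq // => B B'; rewrite !mem_enum.
move=> /S_unit[_ B2] /S_unit[_ B'2] BB'; apply: f_inj.
by move: B2 B'2 BB'; case: (f B) (f B') => [x y] [x' y'] /= -> -> ->.
Qed.

(** One good B in C_1 per A is enough: it cancels one coordinate of A, so the product of coordinates
    of A + B is 0, while A + B itself is not 0. *)
Lemma walk_kernel_toq i : i != Some 0 -> i != Some 1 -> D^-1 <= K i None.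
Proof.
move=> i0 i1; rewrite -[leLHS]mul1r -[1]/1%:R; apply: walk_kernel_ge; first exact: card_curve_gt0.
move=> A Ai; have fA0 := coord_neq0 i0 Ai.
have fA1 : (f A).1 * (f A).2 != 1.
  rewrite -mem_curve_some ?oner_neq0 //; apply: contra i1 => A1.
  by move: Ai A1; rewrite !mem_curve => /eqP -> /eqP ->.
have [g gK Kg] := f_bij.
suff [w w1 /andP[ABq AB0]] : exists2 w : F * F, w.1 * w.2 = 1 &
    (((f A).1 + w.1) * ((f A).2 + w.2) == 0) && (f A + w != 0).
  rewrite (bigD1 (g w)) /=; last by rewrite mem_curve_some ?oner_neq0 // Kg w1.
  by rewrite mem_curve_none fD Kg ABq AB0.
(* If x = 0, cancel y, and the sum is (-1/y, 0). Otherwise cancel x, and the sum is (0, y - 1/x),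
   nonzero because xy is not 1. *)
case: (f A) fA0 fA1 => x y /= fA0 fA1; have [x0|x0] := eqVneq x 0.
  have y0 : y != 0 by apply: contraNneq fA0 => y0; rewrite x0 y0.
  exists (- y^-1, - y) => /=; first by rewrite mulrNN mulVf.
  by rewrite subrr mulr0 eqxx /= xpair_eqE negb_and x0 add0r oppr_eq0 invr_eq0 y0.
exists (- x, - x^-1) => /=; first by rewrite mulrNN divff.
rewrite subrr mul0r eqxx /= xpair_eqE negb_and orbC; apply/orP; left.
by apply: contraNneq fA1 => /subr0_eq /= ->; rewrite divff.
Qed.

(** * Minorization of the three-step kernel *)

Hypothesis F_ge5 : (5 <= #|F|)%N.

Let D_ge4 : 4 <= D.
Proof. by rewrite /D card_curve_some ?oner_neq0 // (ler_nat R 4); lia. Qed.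

Let generic : pred (option F) := fun z => (z != Some 0) && (z != Some 1).

Let stochK : stochastic K.
Proof. by apply: stochastic_walk; exact: card_curve_gt0. Qed.

Let to_generic x : \sum_(z | generic z) K x z = 1 - K x (Some 0) - K x (Some 1).
Proof.
have [_ K1] := stochK; have := K1 x; rewrite (bigD1 (Some 0)) //= (bigD1 (Some 1)) /=.
  by move=> <-; rewrite /generic; ring.
by apply/eqP => -[/eqP]; rewrite oner_eq0.
Qed.

(** Here 1/D is at most 1/4. The walk enters C_1 with probability at most 2/D, leaving 1/2; from C_1
    a return to C_0 costs a further 1/D, leaving 1/4. *)
Let to_generic_ge x : x != Some 0 ->
  (if x == Some 1 then 4^-1 else 2^-1) <= \sum_(z | generic z) K x z.
Proof.
move=> x0; rewrite to_generic.
have := walk_kernel_to0 R card_curve_gt0 x; have := walk_kernel_to1 x0; rewrite -/D.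
have D_inv : D^-1 <= 4^-1 by rewrite lef_pV2 ?posrE // (lt_le_trans _ D_ge4).
by case: (x == Some 1); rewrite ?mul0r ?mul1r; lra.
Qed.

(** From C_0 the first step is forced to C_1, and the second is generic with probability at least
    1/4. From elsewhere, both steps are generic with probability at least 1/4 * 1/2. *)
Let to_generic2 x : 8^-1 <= \sum_(z | generic z) kernel_pow K 2 x z.
Proof.
have [K0 K1] := stochK.
have -> : \sum_(z | generic z) kernel_pow K 2 x z
    = \sum_y K x y * \sum_(z | generic z) K y z.
  under eq_bigr do rewrite (kernel_powD _ 1 1).
  rewrite exchange_big; apply: eq_bigr => y _; rewrite mulr_sumr.
  by apply: eq_bigr => z _; rewrite !kernel_pow1.
have mass0 y : 0 <= \sum_(z | generic z) K y z by apply: sumr_ge0.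
have [->|x0] := eqVneq x (Some 0).
  rewrite (bigD1 (Some 1)) //= walk_kernel01 ?mul1r; last exact: card_curve_gt0.
  have : 0 <= \sum_(y | y != Some 1) K (Some 0) y * \sum_(z | generic z) K y z.
    by apply: sumr_ge0 => y _; apply: mulr_ge0.
  have : Some 1 != Some 0 :> option F by apply/eqP => -[/eqP]; rewrite oner_eq0.
  by move=> /to_generic_ge; rewrite eqxx; lra.
rewrite (bigID generic) /= -[leLHS]addr0; apply: lerD; last first.
  by apply: sumr_ge0 => y _; apply: mulr_ge0.
apply: (@le_trans _ _ (\sum_(y | generic y) K x y * 2^-1)).
  rewrite -mulr_suml; have := to_generic_ge x0.
  by case: (x == Some 1); lra.
apply: ler_sum => y /andP[y0 y1]; apply: ler_wpM2l => //.
by have := to_generic_ge y0; rewrite (negPf y1).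
Qed.

Lemma walk_minorization x : 8^-1 / D <= kernel_pow K 3 x None.
Proof.
apply: (kernel_pow_step stochK) (to_generic2 x).
  by rewrite invr_ge0.
by move=> z /andP[z0 z1]; exact: walk_kernel_toq.
Qed.

End Hyperbolic.

(** * Limit distribution and linear mixing time *)

Theorem theorem5 (R : realType) :
  (forall (q : nat) (F : finFieldType) (a b c : F),
     #|F| = q -> odd q -> q = 1 %[mod 4] ->
     a != 0 -> b != 0 -> c != 0 -> a * b = c ^+ 2 ->
     [/\ ((fun n : nat => C1_pow R a b n (Some 0)) @ \oo
            --> (1 / q%:R ^+ 2 : R))%classic,
         ((fun n : nat => C1_pow R a b n None) @ \oo
            --> (2 * (q%:R - 1) / q%:R ^+ 2 : R))%classic
       & forall i : F, i != 0 ->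
         ((fun n : nat => C1_pow R a b n (Some i)) @ \oo
            --> ((q%:R - 1) / q%:R ^+ 2 : R))%classic])
  /\
  (forall eps : R, 0 < eps -> eps < 1 ->
     exists M : R, forall (q : nat) (F : finFieldType) (a b c : F),
       #|F| = q -> odd q -> q = 1 %[mod 4] ->
       a != 0 -> b != 0 -> c != 0 -> a * b = c ^+ 2 ->
       exists2 pi : {ffun option F -> R},
         unique (stationary (walk_kernel R a b)) pi
         & (mixing_time (walk_kernel R a b) pi eps <= (M * q%:R)%:E)%E).
Proof.
have card_ge5 (F : finFieldType) : #|F| = 1 %[mod 4] -> (5 <= #|F|)%N.
  have : (1 < #|F|)%N := finNzRing_gt1 F.
  by case: #|F| => [|[|[|[|[|n]]]]].
split=> [q F a b c Fq _|eps eps0 eps1].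
  rewrite -{}Fq => F_mod a0 _ c0 abc; have F_ge5 := card_ge5 F F_mod.
  have [f [f_bij fD fQ]] := hyperbolic_coordinates F_mod a0 c0 abc.
  have C_gt0 := card_curve_gt0 f_bij fQ.
  have d0 : 0 < 8^-1 / #|curve a b (Some 1)|%:R :> R.
    by rewrite divr_gt0 ?invr_gt0 ?ltr0n.
  have cvg k : ((fun n => C1_pow R a b n k) @ \oo
      --> (#|curve a b k|%:R / #|F|%:R ^+ 2 : R))%classic.
    have := doeblin_cvg (y := k) (stochastic_walk R C_gt0) (stationary_walk R C_gt0)
      d0 (walk_minorization R f_bij fD fQ F_ge5) (Some 0).
    rewrite ffunE; apply: cvg_trans; apply: near_eq_cvg.
    by near=> n; rewrite C1_pow_kernel.
  have F1 : #|F|.-1%:R = #|F|%:R - 1 :> R.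
    by rewrite -subn1 natrB // (leq_trans _ F_ge5).
  split=> [||i i0].
  - by have := cvg (Some 0); rewrite card_curve0.
  - by have := cvg None; rewrite (card_curve_none f_bij fQ) natrM F1.
  - by have := cvg (Some i); rewrite (card_curve_some f_bij fQ i0) F1.
(* Ensures eps * k >= 1. With n = 8 k q blocks of 3 steps and d = 1/(8(q - 1)), n d is at least k;
   the total time is 24 k q. *)
pose k := (Num.truncn eps^-1).+1.
exists (24 * k)%:R => q F a b c Fq _.
rewrite -{}Fq => F_mod a0 _ c0 abc; have F_ge5 := card_ge5 F F_mod.
have [f [f_bij fD fQ]] := hyperbolic_coordinates F_mod a0 c0 abc.
have C_gt0 := card_curve_gt0 f_bij fQ.
have d0 : 0 < 8^-1 / #|curve a b (Some 1)|%:R :> R.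
  by rewrite divr_gt0 ?invr_gt0 ?ltr0n.
have stochK := stochastic_walk R C_gt0; have pi_stat := stationary_walk R C_gt0.
have K_min := walk_minorization R f_bij fD fQ F_ge5.
exists [ffun k => #|curve a b k|%:R / #|F|%:R ^+ 2].
  exact: doeblin_unique stochK pi_stat d0 K_min.
rewrite -natrM (_ : 24 * k * #|F| = 8 * k * #|F| * 3)%N; last by lia.
apply: (doeblin_mixing_time stochK pi_stat d0 K_min) => //.
have epsk : 1 <= eps * k%:R.
  by rewrite mulrC -ler_pdivrMr // div1r ltW // truncnS_gt.
apply: le_trans epsk _; rewrite ler_pM2l //.
rewrite (card_curve_some f_bij fQ) ?oner_neq0 // -[leLHS]add0r lerD //.
rewrite !natrM mulrA ler_pdivlMr; last by rewrite ltr0n; lia.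
have : #|F|.-1%:R <= #|F|%:R :> R by rewrite ler_nat leq_pred.
have : 0 <= k%:R :> R by [].
nra.
Unshelve. all: by end_near.
Qed.
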